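(* An algebra $A\in\mathsf{G^*A}$ is $c^*$-compact (in $\mathsf{G^*A}$) if and only if the reflection $\alpha_A=\eta_A:A\to C^*(A)$ is surjective.
   Context: A $*$-algebra is a complex algebra with an involution $a\mapsto a^*$ satisfying $(a+\lambda b)^*=a^*+\bar\lambda b^*$ and $(ab)^*=b^*a^*$. A topological $*$-algebra is a $*$-algebra with a topology making addition, multiplication, additive inverse and involution jointly continuous; $\mathsf{T^*A}$ is the category of topological $*$-algebras and continuous $*$-homomorphisms; subobjects are $*$-subalgebras with the subspace topology. A $C^*$-seminorm on $A$ is a seminorm $p$ with $p(ab)\le p(a)p(b)$ and $p(a^*a)=p(a)^2$. $\mathcal N(A)$ is the set of continuous $C^*$-seminorms on $A$, directed pointwise. For $p\in\mathcal N(A)$, $A_p$ is the completion of $A/\ker p$ with respect to the $C^*$-norm induced by $p$. $\mathcal T_A$ (the $*$-representation topology) is the initial topology on $A$ induced by $\mathcal N(A)$; for a $*$-subalgebra $S\subseteq A$, $c^*_A(S)$ is the closure of $S$ in $\mathcal T_A$. $\mathsf{G^*A}$ is the full subcategory of $\mathsf{T^*A}$ of algebras $A$ for which $\mathcal N(A)$ has a largest element $r$; for such $A$, the enveloping $C^*$-algebra is $C^*(A):=\lim_{p\in\mathcal N(A)}A_p\cong A_r$, and $\eta_A:A\to C^*(A)$, $\eta_A(x)=(x+\ker p)_p$, is the reflection of $A$ into the category of $C^*$-algebras. $A\in\mathsf{G^*A}$ is $c^*$-compact (in $\mathsf{G^*A}$) if for every $B\in\mathsf{G^*A}$ and every $*$-subalgebra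 $S\subseteq A\times B$, $\pi_B(c^*_{A\times B}(S))=c^*_B(\pi_B(S))$, where $\pi_B:A\times B\to B$ is the projection. *)

(* Defs.v *)
From Stdlib Require Import Reals List.
From Coquelicot Require Import Coquelicot.
Open Scope R_scope.

(** Raw signature of a (possibly non-unital) complex *-algebra with a topology,
    given by its set of open sets.  The axioms are imposed separately by
    [TStarAlg], so that products can be formed without proof obligations. *)
Record tsig := TSig {
  car :> Type;
  zero : car;
  add : car -> car -> car;
  opp : car -> car;
  mul : car -> car -> car;
  scale : C -> car -> car;
  star : car -> car;
  opens : (car -> Prop) -> Prop
}.

Definition sub (X : tsig) (a b : car X) : car X := add X a (opp X b).

Definition is_topology (X : tsig) : Prop :=
  opens X (fun _ => True) /\
  (forall (F : (car X -> Prop) -> Prop), (forall U, F U -> opens X U) ->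
      opens X (fun x => exists U, F U /\ U x)) /\
  (forall U V, opens X U -> opens X V -> opens X (fun x => U x /\ V x)).

Definition cont1 (X : tsig) (f : car X -> car X) : Prop :=
  forall x U, opens X U -> U (f x) ->
    exists V, opens X V /\ V x /\ forall y, V y -> U (f y).

Definition cont2 (X : tsig) (f : car X -> car X -> car X) : Prop :=
  forall x y U, opens X U -> U (f x y) ->
    exists V W, opens X V /\ opens X W /\ V x /\ W y /\
      forall x' y', V x' -> W y' -> U (f x' y').

Definition star_alg_axioms (X : tsig) : Prop :=
  (forall a b c, add X a (add X b c) = add X (add X a b) c) /\
  (forall a b, add X a b = add X b a) /\
  (forall a, add X a (zero X) = a) /\
  (forall a, add X a (opp X a) = zero X) /\
  (forall l a b, scale X l (add X a b) = add X (scale X l a) (scale X l b)) /\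
  (forall l m a, scale X (Cplus l m) a = add X (scale X l a) (scale X m a)) /\
  (forall l m a, scale X (Cmult l m) a = scale X l (scale X m a)) /\
  (forall a, scale X (RtoC 1) a = a) /\
  (forall a b c, mul X a (mul X b c) = mul X (mul X a b) c) /\
  (forall a b c, mul X a (add X b c) = add X (mul X a b) (mul X a c)) /\
  (forall a b c, mul X (add X a b) c = add X (mul X a c) (mul X b c)) /\
  (forall l a b, mul X (scale X l a) b = scale X l (mul X a b)) /\
  (forall l a b, mul X a (scale X l b) = scale X l (mul X a b)) /\
  (forall a, star X (star X a) = a) /\
  (forall l a b, star X (add X a (scale X l b)) =
                 add X (star X a) (scale X (Cconj l) (star X b))) /\
  (forall a b, star X (mul X a b) = mul X (star X b) (star X a)).

Definition TStarAlg (X : tsig) : Prop :=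
  star_alg_axioms X /\ is_topology X /\
  cont2 X (add X) /\ cont2 X (mul X) /\ cont1 X (opp X) /\ cont1 X (star X).

Definition cstar_seminorm (X : tsig) (p : car X -> R) : Prop :=
  (forall a b, p (add X a b) <= p a + p b) /\
  (forall l a, p (scale X l a) = Cmod l * p a) /\
  (forall a b, p (mul X a b) <= p a * p b) /\
  (forall a, p (mul X (star X a) a) = (p a) ^ 2).

Definition continuous_real (X : tsig) (p : car X -> R) : Prop :=
  forall x eps, 0 < eps ->
    exists U, opens X U /\ U x /\ forall y, U y -> Rabs (p y - p x) < eps.

Definition NA (X : tsig) (p : car X -> R) : Prop :=
  cstar_seminorm X p /\ continuous_real X p.

Definition largest_NA (X : tsig) (r : car X -> R) : Prop :=
  NA X r /\ forall p, NA X p -> forall a, p a <= r a.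

Definition GStarA (X : tsig) : Prop :=
  TStarAlg X /\ exists r, largest_NA X r.

Definition star_subalg (X : tsig) (S : car X -> Prop) : Prop :=
  S (zero X) /\
  (forall a b, S a -> S b -> S (add X a b)) /\
  (forall l a, S a -> S (scale X l a)) /\
  (forall a b, S a -> S b -> S (mul X a b)) /\
  (forall a, S a -> S (star X a)).

(** Closure in the *-representation topology T_A, i.e. the initial topology
    induced by N(A) (basic neighbourhoods given by finitely many p in N(A)). *)
Definition cstar_closure (X : tsig) (S : car X -> Prop) (x : car X) : Prop :=
  forall (ps : list (car X -> R)), (forall p, In p ps -> NA X p) ->
  forall eps, 0 < eps ->
    exists s, S s /\ forall p, In p ps -> p (sub X x s) < eps.

Definition prod_tsig (A B : tsig) : tsig :=
  TSig (car A * car B)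
    (zero A, zero B)
    (fun x y => (add A (fst x) (fst y), add B (snd x) (snd y)))
    (fun x => (opp A (fst x), opp B (snd x)))
    (fun x y => (mul A (fst x) (fst y), mul B (snd x) (snd y)))
    (fun l x => (scale A l (fst x), scale B l (snd x)))
    (fun x => (star A (fst x), star B (snd x)))
    (fun U => forall x, U x -> exists V W, opens A V /\ opens B W /\
        V (fst x) /\ W (snd x) /\ forall a b, V a -> W b -> U (a, b)).

Definition proj2_img (A B : tsig) (T : car A * car B -> Prop) : car B -> Prop :=
  fun b => exists a, T (a, b).

Definition cstar_compact (A : tsig) : Prop :=
  forall B : tsig, GStarA B ->
  forall S : car (prod_tsig A B) -> Prop, star_subalg (prod_tsig A B) S ->
  forall b : car B,
    proj2_img A B (cstar_closure (prod_tsig A B) S) b <->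
    cstar_closure B (proj2_img A B S) b.

(** Completion A_p of A/ker p: (classes of) p-Cauchy sequences in A; the
    canonical map eta sends a to the class of the constant sequence. *)
Definition p_cauchy (X : tsig) (p : car X -> R) (u : nat -> car X) : Prop :=
  forall eps, 0 < eps -> exists N, forall n m, (N <= n)%nat -> (N <= m)%nat ->
    p (sub X (u n) (u m)) < eps.

Definition completion_pt (X : tsig) (p : car X -> R) : Type :=
  { u : nat -> car X | p_cauchy X p u }.

Definition completion_eq (X : tsig) (p : car X -> R) (u v : nat -> car X) : Prop :=
  forall eps, 0 < eps -> exists N, forall n, (N <= n)%nat ->
    p (sub X (u n) (v n)) < eps.

Definition eta_surjective (X : tsig) (r : car X -> R) : Prop :=
  forall z : completion_pt X r, exists a : car X,
    completion_eq X r (fun _ => a) (proj1_sig z).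

(* Main.v *)
(** If [C*(A) = A / ker r], an element [b] of the closure of the projection of a
    *-subalgebra [T] is a limit of second coordinates of elements of [T]; these
    can be corrected inside [T] so that the first coordinates become
    [r]-Cauchy, as soon as every [x] in [T] with small second coordinate is
    approximated, in the second coordinate, by elements of [T] which are small
    in both.  For skew [u] the element [exp u - 1] does this: [exp u] is
    unitary, so its norm is bounded by an absolute constant for every
    C*-seminorm, while [exp u - 1] is close to [u] wherever [u] is small.  In an
    incomplete non-unital algebra we use [(1 + u / N) ^ N - 1] for large [N].
    A geometric iteration concludes, without any spectral theory.

    Conversely, apply compactness to the graph of the canonical map from [A]
    into its completion: its projection is dense, so every point of the
    completion is in the image of [A] up to norm zero. *)

Require Import Defs.
From Stdlib Require Import Reals List Lra Lia.
From Stdlib Require Import FunctionalExtensionality ProofIrrelevance.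
From Stdlib Require Import ClassicalEpsilon.
From Coquelicot Require Import Coquelicot.
(* Coquelicot shadows [zero], [opp] and [scale]. *)
Import Defs.
Open Scope R_scope.

(** * Identities in a possibly non-unital *-algebra *)

Section StarAlgebra.

Variables (X : tsig) (HX : star_alg_axioms X).

Local Infix "[+]" := (add X) (at level 50, left associativity).
Local Infix "[*]" := (mul X) (at level 40, left associativity).
Local Notation "[-] a" := (opp X a) (at level 35, right associativity).
Local Notation "a ^*" := (star X a) (at level 30, format "a ^*").
Local Notation "0'" := (zero X).

Lemma add_assoc a b c : a [+] (b [+] c) = a [+] b [+] c.
Proof. apply HX. Qed.

Lemma add_comm a b : a [+] b = b [+] a.
Proof. apply HX. Qed.

Lemma add_zero_r a : a [+] 0' = a.
Proof. apply HX. Qed.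

Lemma add_opp_r a : a [+] [-] a = 0'.
Proof. apply HX. Qed.

Lemma scale_add_r l a b : scale X l (a [+] b) = scale X l a [+] scale X l b.
Proof. apply HX. Qed.

Lemma scale_add_l l m a : scale X (Cplus l m) a = scale X l a [+] scale X m a.
Proof. apply HX. Qed.

Lemma scale_scale l m a : scale X l (scale X m a) = scale X (Cmult l m) a.
Proof. symmetry; apply HX. Qed.

Lemma scale_one a : scale X (RtoC 1) a = a.
Proof. apply HX. Qed.

Lemma mul_assoc a b c : a [*] (b [*] c) = a [*] b [*] c.
Proof. apply HX. Qed.

Lemma mul_add_r a b c : a [*] (b [+] c) = a [*] b [+] a [*] c.
Proof. apply HX. Qed.

Lemma mul_add_l a b c : (a [+] b) [*] c = a [*] c [+] b [*] c.
Proof. apply HX. Qed.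

Lemma mul_scale_l l a b : scale X l a [*] b = scale X l (a [*] b).
Proof. apply HX. Qed.

Lemma mul_scale_r l a b : a [*] scale X l b = scale X l (a [*] b).
Proof. apply HX. Qed.

Lemma star_star a : (a^*)^* = a.
Proof. apply HX. Qed.

Lemma star_add_scale l a b :
  (a [+] scale X l b)^* = a^* [+] scale X (Cconj l) (b^*).
Proof. apply HX. Qed.

Lemma star_mul a b : (a [*] b)^* = b^* [*] a^*.
Proof. apply HX. Qed.

Lemma add_left_comm a b c : a [+] (b [+] c) = b [+] (a [+] c).
Proof. now rewrite !add_assoc, (add_comm a b). Qed.

Lemma add_zero_l a : 0' [+] a = a.
Proof. rewrite add_comm; apply add_zero_r. Qed.

Lemma add_opp_l a : [-] a [+] a = 0'.
Proof. rewrite add_comm; apply add_opp_r. Qed.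

Lemma add_cancel_l a b c : a [+] b = a [+] c -> b = c.
Proof.
intros E.
rewrite <- (add_zero_l b), <- (add_opp_l a), <- add_assoc, E, add_assoc.
now rewrite add_opp_l, add_zero_l.
Qed.

Lemma scale_zero_l a : scale X (RtoC 0) a = 0'.
Proof.
apply (add_cancel_l (scale X (RtoC 0) a)).
rewrite <- scale_add_l, add_zero_r.
now rewrite Cplus_0_r.
Qed.

Lemma scale_zero_r l : scale X l 0' = 0'.
Proof.
apply (add_cancel_l (scale X l 0')).
now rewrite <- scale_add_r, !add_zero_r.
Qed.

Lemma mul_zero_r a : a [*] 0' = 0'.
Proof.
apply (add_cancel_l (a [*] 0')).
now rewrite <- mul_add_r, !add_zero_r.
Qed.

Lemma opp_scale a : [-] a = scale X (RtoC (-1)) a.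
Proof.
apply (add_cancel_l a); rewrite add_opp_r.
rewrite <- (scale_one a) at 1.
rewrite <- scale_add_l, <- RtoC_plus.
replace (1 + -1) with 0 by ring.
now rewrite scale_zero_l.
Qed.

Lemma star_add a b : (a [+] b)^* = a^* [+] b^*.
Proof.
rewrite <- (scale_one b) at 1.
rewrite star_add_scale.
replace (Cconj (RtoC 1)) with (RtoC 1).
  now rewrite scale_one.
unfold Cconj, RtoC; simpl; f_equal; ring.
Qed.

Lemma star_zero : 0'^* = 0'.
Proof.
apply (add_cancel_l (0'^*)).
now rewrite <- star_add, !add_zero_r.
Qed.

Lemma star_scale l a : (scale X l a)^* = scale X (Cconj l) (a^*).
Proof.
rewrite <- (add_zero_l (scale X l a)), star_add_scale, star_zero.
apply add_zero_l.
Qed.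

Lemma star_opp a : ([-] a)^* = [-] (a^*).
Proof.
rewrite !opp_scale, star_scale; f_equal.
unfold Cconj, RtoC; simpl; f_equal; ring.
Qed.

Lemma opp_add a b : [-] (a [+] b) = [-] a [+] [-] b.
Proof. rewrite !opp_scale; apply scale_add_r. Qed.

Lemma opp_opp a : [-] [-] a = a.
Proof.
apply (add_cancel_l ([-] a)); now rewrite add_opp_r, add_opp_l.
Qed.

Lemma opp_zero : [-] 0' = 0'.
Proof. now rewrite opp_scale, scale_zero_r. Qed.

Lemma scale_opp l a : scale X l ([-] a) = [-] scale X l a.
Proof. now rewrite !opp_scale, !scale_scale, Cmult_comm. Qed.

Lemma mul_opp_l a b : [-] a [*] b = [-] (a [*] b).
Proof. now rewrite !opp_scale, mul_scale_l. Qed.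

Lemma mul_opp_r a b : a [*] [-] b = [-] (a [*] b).
Proof. now rewrite !opp_scale, mul_scale_r. Qed.

Lemma add_opp_cancel a b : a [+] ([-] a [+] b) = b.
Proof. now rewrite add_assoc, add_opp_r, add_zero_l. Qed.

Lemma opp_add_cancel a b : [-] a [+] (a [+] b) = b.
Proof. now rewrite add_assoc, add_opp_l, add_zero_l. Qed.

Lemma sub_sub_sub a b c : sub X a c = sub X a b [+] sub X b c.
Proof.
unfold sub; rewrite <- add_assoc; f_equal.
now rewrite opp_add_cancel.
Qed.

Lemma sub_diag a : sub X a a = 0'.
Proof. apply add_opp_r. Qed.

Lemma opp_sub a b : [-] sub X a b = sub X b a.
Proof. unfold sub; now rewrite opp_add, opp_opp, add_comm. Qed.

Lemma sub_add a b : sub X a b [+] b = a.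
Proof. unfold sub; now rewrite <- add_assoc, add_opp_l, add_zero_r. Qed.

Lemma sub_add_add a b c d :
  sub X (a [+] b) (c [+] d) = sub X a c [+] sub X b d.
Proof.
unfold sub; rewrite opp_add, <- !add_assoc; f_equal.
apply add_left_comm.
Qed.

Lemma sub_opp_opp a b : sub X ([-] a) ([-] b) = [-] sub X a b.
Proof. unfold sub; now rewrite opp_add. Qed.

Lemma sub_star_star a b : sub X (a^*) (b^*) = (sub X a b)^*.
Proof. unfold sub; now rewrite star_add, star_opp. Qed.

Lemma sub_scale_scale l a b :
  sub X (scale X l a) (scale X l b) = scale X l (sub X a b).
Proof. unfold sub; now rewrite scale_add_r, scale_opp. Qed.

Lemma sub_mul_mul a b c d :
  sub X (a [*] b) (c [*] d) = a [*] sub X b d [+] sub X a c [*] d.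
Proof.
rewrite (sub_sub_sub _ (a [*] d)); unfold sub.
now rewrite mul_add_r, mul_add_l, mul_opp_l, mul_opp_r.
Qed.

(** The product of the unitization transported by [x |-> 1 + x]. *)
Definition circ a b := a [+] b [+] a [*] b.

Lemma circ_assoc a b c : circ a (circ b c) = circ (circ a b) c.
Proof.
unfold circ; rewrite !mul_add_r, !mul_add_l, !mul_assoc, <- !add_assoc.
f_equal; f_equal.
rewrite (add_left_comm (a [*] b) c); f_equal.
now rewrite (add_left_comm (b [*] c) (a [*] b)), (add_left_comm _ (a [*] c)).
Qed.

Lemma star_circ a b : (circ a b)^* = circ (b^*) (a^*).
Proof.
unfold circ; rewrite !star_add, star_mul; f_equal; apply add_comm.
Qed.

Lemma circ_add_r a b c : circ a (b [+] c) = circ a b [+] (c [+] a [*] c).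
Proof.
unfold circ; rewrite mul_add_r, <- !add_assoc; do 2 f_equal.
apply add_left_comm.
Qed.

(** This is [(1 + a) ^ n - 1] computed in the unitization. *)
Fixpoint circ_pow a n :=
  match n with
  | O => 0'
  | S n => circ (circ_pow a n) a
  end.

(** * Estimates for one C*-seminorm *)

Section Seminorm.

Variables (p : X -> R) (Hp : cstar_seminorm X p).

Lemma sn_add a b : p (a [+] b) <= p a + p b.
Proof. apply Hp. Qed.

Lemma sn_scale l a : p (scale X l a) = Cmod l * p a.
Proof. apply Hp. Qed.

Lemma sn_mul a b : p (a [*] b) <= p a * p b.
Proof. apply Hp. Qed.

Lemma sn_star_mul a : p (a^* [*] a) = p a ^ 2.
Proof. apply Hp. Qed.

Lemma sn_zero : p 0' = 0.
Proof.
rewrite <- (scale_zero_l 0'), sn_scale, Cmod_0; ring.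
Qed.

Lemma sn_opp a : p ([-] a) = p a.
Proof.
rewrite opp_scale, sn_scale, Cmod_R.
rewrite Rabs_left by lra; ring.
Qed.

Lemma sn_ge0 a : 0 <= p a.
Proof.
generalize (sn_add a ([-] a)); rewrite add_opp_r, sn_zero, sn_opp; lra.
Qed.

(** The C*-identity and submultiplicativity bound [p a ^ 2] by [p a] times the seminorm of [a^*];
    dividing by [p a] is harmless, since for [p a = 0] nonnegativity suffices. *)
Lemma sn_star_le a : p a <= p (a^*).
Proof.
generalize (sn_ge0 a) (sn_ge0 (a^*)) (sn_mul (a^*) a).
rewrite sn_star_mul; nra.
Qed.

Lemma sn_star a : p (a^*) = p a.
Proof.
apply Rle_antisym; [|apply sn_star_le].
rewrite <- (star_star a) at 2; apply sn_star_le.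
Qed.

Lemma sn_sub a b : p (sub X a b) <= p a + p b.
Proof. rewrite <- (sn_opp b); apply sn_add. Qed.

Lemma sn_sub_comm a b : p (sub X a b) = p (sub X b a).
Proof. now rewrite <- opp_sub, sn_opp. Qed.

Lemma sn_sub_triangle b a c : p (sub X a c) <= p (sub X a b) + p (sub X b c).
Proof. rewrite (sub_sub_sub a b c); apply sn_add. Qed.

Lemma sn_le_sub a b : p a <= p b + p (sub X a b).
Proof. rewrite <- (sub_add a b) at 1; rewrite Rplus_comm; apply sn_add. Qed.

Lemma sn_dist a b : Rabs (p a - p b) <= p (sub X a b).
Proof.
generalize (sn_le_sub a b) (sn_le_sub b a); rewrite (sn_sub_comm b a).
intros; apply Rabs_le; lra.
Qed.

(** With [v = 1 + w] and [a] skew, [v^* v - 1] grows only at second order. *)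
Lemma sn_circ_step a e :
  a^* = [-] a ->
  p (circ (a^*) (circ e a)) <= p a ^ 2 + (1 + p a) ^ 2 * p e.
Proof.
intros Ha.
assert (E : circ e a = a [+] (e [+] e [*] a)).
  unfold circ; rewrite <- !add_assoc; apply add_left_comm.
rewrite E, circ_add_r.
(* Skewness makes [a^* [+] a] vanish, so only the quadratic term is left. *)
assert (E0 : circ (a^*) a = a^* [*] a).
  unfold circ; rewrite Ha, add_opp_l; apply add_zero_l.
rewrite E0.
set (f := e [+] e [*] a).
assert (Hf : p f <= (1 + p a) * p e).
  unfold f; generalize (sn_add e (e [*] a)) (sn_mul e a); lra.
generalize (sn_add (a^* [*] a) (f [+] a^* [*] f)) (sn_add f (a^* [*] f)).
generalize (sn_mul (a^*) f) (sn_ge0 a); rewrite sn_star_mul, sn_star.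
nra.
Qed.

(** Put [v_n = (1 + a) ^ n]. Then [v_(n+1)^* v_(n+1)] arises from [v_n^* v_n] by multiplying with
    [(1 + a)^*] on the left and [1 + a] on the right, so each step adds [p a ^ 2] and multiplies the
    defect by at most [(1 + p a) ^ 2 <= exp (2 * p a)]. When [p a] is of order [1 / n], the bound is
    of order [1 / n] too. *)
Lemma sn_circ_star_pow a n :
  a^* = [-] a ->
  p (circ ((circ_pow a n)^*) (circ_pow a n)) <=
    INR n * p a ^ 2 * exp (2 * INR n * p a).
Proof.
intros Ha; generalize (sn_ge0 a); intros Ha0.
induction n as [|n IH].
  simpl; rewrite star_zero; unfold circ.
  rewrite mul_zero_r, !add_zero_r, sn_zero; lra.
cbn [circ_pow]; rewrite star_circ, <- circ_assoc, (circ_assoc _ _ a).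
eapply Rle_trans; [now apply sn_circ_step|].
rewrite S_INR.
replace (2 * (INR n + 1) * p a) with (2 * INR n * p a + (p a + p a)) by ring.
rewrite !exp_plus.
assert (H1 := exp_ineq1_le (p a)).
assert (H2 : 1 <= exp (2 * INR n * p a)).
  generalize (exp_ineq1_le (2 * INR n * p a)) (pos_INR n); nra.
assert (H3 : (1 + p a) ^ 2 <= exp (p a) * exp (p a)) by nra.
set (E := exp (2 * INR n * p a)) in *.
set (F := exp (p a) * exp (p a)) in *.
assert (H4 : 1 <= F) by nra.
assert (H5 : 1 <= E * F) by nra.
assert (H6 : (1 + p a) ^ 2 * p (circ ((circ_pow a n)^*) (circ_pow a n))
  <= F * (INR n * p a ^ 2 * E)).
  apply Rmult_le_compat; try assumption; [nra|apply sn_ge0].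
assert (H7 : p a ^ 2 * 1 <= p a ^ 2 * (E * F)).
  apply Rmult_le_compat_l; [apply pow2_ge_0|assumption].
lra.
Qed.

(** [1 + w] is then almost unitary, so [w] is bounded by an absolute constant. *)
Lemma sn_circ_star_bound w : p (circ (w^*) w) <= 3 -> p w <= 3.
Proof.
intros H.
assert (E : w^* [*] w = sub X (sub X (circ (w^*) w) w) (w^*)).
  unfold sub, circ.
  rewrite (add_comm (w^*) w), (add_comm _ (w^* [*] w)), <- !add_assoc.
  rewrite (add_left_comm (w^*) ([-] w)), add_opp_cancel, add_opp_r.
  now rewrite add_zero_r.
(* With [t = p w] the identity gives [t ^ 2 <= 3 + 2 * t], that is [(t - 3) * (t + 1) <= 0]. *)
generalize (sn_star_mul w) (sn_ge0 w); rewrite E.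
generalize (sn_sub (sub X (circ (w^*) w) w) (w^*)) (sn_sub (circ (w^*) w) w).
rewrite sn_star; nra.
Qed.

(** By induction the current power is at most [/ 2], so one more factor adds at most
    [3 / 2 * p a]. *)
Lemma sn_circ_pow a n : 4 * (INR n * p a) <= 1 ->
  p (circ_pow a n) <= 2 * (INR n * p a).
Proof.
generalize (sn_ge0 a); intros Ha.
induction n as [|n IH].
  simpl; rewrite sn_zero; lra.
rewrite S_INR; intros H; cbn [circ_pow]; unfold circ.
assert (IH' : p (circ_pow a n) <= 2 * (INR n * p a)) by (apply IH; lra).
generalize (sn_add (circ_pow a n [+] a) (circ_pow a n [*] a)).
generalize (sn_add (circ_pow a n) a) (sn_mul (circ_pow a n) a).
nra.
Qed.

(** The error grows by [circ_pow a n [*] a] at each step, hence by at most [2 * n * p a ^ 2], and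
    [n ^ 2 + 2 * n <= (n + 1) ^ 2]. *)
Lemma sn_circ_pow_linear a n : 4 * (INR n * p a) <= 1 ->
  p (sub X (circ_pow a n) (scale X (RtoC (INR n)) a)) <= (INR n * p a) ^ 2.
Proof.
generalize (sn_ge0 a); intros Ha.
induction n as [|n IH].
  simpl circ_pow; simpl INR; rewrite scale_zero_l, sub_diag, sn_zero; nra.
intros H; assert (H' := H); revert H'; rewrite S_INR; intros H'.
assert (Hn : 4 * (INR n * p a) <= 1) by lra.
generalize (IH Hn) (sn_circ_pow a n Hn); intros H1 H2.
assert (E : sub X (circ_pow a (S n)) (scale X (RtoC (INR n + 1)) a) =
  sub X (circ_pow a n) (scale X (RtoC (INR n)) a) [+] circ_pow a n [*] a).
  cbn [circ_pow]; unfold circ, sub.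
  rewrite RtoC_plus, scale_add_l, scale_one, opp_add, <- !add_assoc; f_equal.
  rewrite (add_comm _ ([-] a)), (add_left_comm _ ([-] a)), add_opp_cancel.
  apply add_comm.
rewrite E.
generalize (sn_add (sub X (circ_pow a n) (scale X (RtoC (INR n)) a))
  (circ_pow a n [*] a)) (sn_mul (circ_pow a n) a).
assert (p (circ_pow a n) * p a <= 2 * (INR n * p a) * p a).
  now apply Rmult_le_compat_r.
nra.
Qed.

End Seminorm.

(** * Approximation in one seminorm with control of another *)

Section Lifting.

Variables (p q : X -> R).
Hypotheses (Hp : cstar_seminorm X p) (Hq : cstar_seminorm X q).
Variable (T : X -> Prop).
Hypothesis (HT : star_subalg X T).

Lemma subalg_opp a : T a -> T ([-] a).
Proof. intros; rewrite opp_scale; now apply HT. Qed.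

Lemma subalg_circ_pow a n : T a -> T (circ_pow a n).
Proof.
destruct HT as (T0 & Tadd & Tscale & Tmul & Tstar).
intros Ha; induction n as [|n IH]; simpl; [assumption|].
unfold circ; auto.
Qed.

Lemma Cmod_RtoC_pos c : 0 <= c -> Cmod (RtoC c) = c.
Proof. intros; rewrite Cmod_R; now apply Rabs_pos_eq. Qed.

(** The point is that the bound on [q y] does not depend on [q u]: a large [q u] only forces a
    larger exponent [N] in [(1 + c u / N) ^ N - 1], whose [q]-seminorm stays at most 3. *)
Lemma lift_skew u e : T u -> u^* = [-] u -> 0 < e -> p u <= e ->
  exists y, T y /\ q y <= 24 * e /\ p (sub X u y) <= e / 8.
Proof.
intros Tu Hu He Hpu.
(* This scaling gives [p (c u) <= / 8], so the second-order error of the power is at most [/ 64]. *)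
set (c := / (8 * e)).
assert (Hc : 0 < c) by (apply Rinv_0_lt_compat; lra).
assert (Hce : c * e = / 8) by (unfold c; field; lra).
set (M := c * q u).
assert (HM : 0 <= M) by (apply Rmult_le_pos; [lra|now apply sn_ge0]).
(* [M ^ 2 * exp (2 * M) / N] is the unitarity defect of the power in the seminorm [q]; this [N]
   brings it below 1, well within the allowed 3. *)
destruct (INR_unbounded (M ^ 2 * exp (2 * M))) as [N HN].
assert (HE := exp_pos (2 * M)).
assert (HN0 : 0 < INR N).
  eapply Rle_lt_trans; [|exact HN].
  apply Rmult_le_pos; [apply pow2_ge_0|lra].
set (a := scale X (RtoC (c / INR N)) u).
assert (Hca : 0 <= c / INR N) by (apply Rdiv_le_0_compat; lra).
assert (Ha : a^* = [-] a).
  unfold a; rewrite star_scale, Hu, scale_opp; do 2 f_equal.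
  unfold Cconj, RtoC; simpl; f_equal; ring.
assert (Hpa : INR N * p a = c * p u).
  unfold a; rewrite sn_scale, Cmod_RtoC_pos by assumption; field; lra.
assert (Hqa : q a = M / INR N).
  unfold a, M; rewrite sn_scale, Cmod_RtoC_pos by assumption; field; lra.
assert (Hcp : 0 <= c * p u <= / 8).
  assert (0 <= p u) by now apply sn_ge0.
  split; [nra|]; rewrite <- Hce; apply Rmult_le_compat_l; lra.
set (w := circ_pow a N).
assert (Hqw : q w <= 3).
  apply sn_circ_star_bound; [assumption|].
  eapply Rle_trans; [now apply sn_circ_star_pow|].
  rewrite Hqa.
  replace (2 * INR N * (M / INR N)) with (2 * M) by (field; lra).
  replace (INR N * (M / INR N) ^ 2 * exp (2 * M))
    with (M ^ 2 * exp (2 * M) / INR N) by (field; lra).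
  apply Rmult_le_reg_r with (INR N); [assumption|].
  unfold Rdiv; rewrite Rmult_assoc, Rinv_l by lra; lra.
assert (Hpw : p (sub X w (scale X (RtoC (INR N)) a)) <= / 64).
  eapply Rle_trans; [apply sn_circ_pow_linear; try assumption|].
    rewrite Hpa; lra.
  rewrite Hpa; nra.
(* Undoing the scaling by [c] multiplies both bounds by [8 * e]: [8 * 3 = 24] and [8 / 64 = / 8]. *)
exists (scale X (RtoC (8 * e)) w); repeat split.
- apply HT; apply subalg_circ_pow; now apply HT.
- rewrite sn_scale, Cmod_RtoC_pos by (assumption || lra); nra.
- assert (E : u = scale X (RtoC (8 * e)) (scale X (RtoC (INR N)) a)).
    unfold a; rewrite !scale_scale, <- !RtoC_mult.
    replace (8 * e * INR N * (c / INR N)) with 1.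
      now rewrite scale_one.
    unfold c; field; lra.
  rewrite E at 1.
  rewrite sub_scale_scale, sn_scale, Cmod_RtoC_pos by (assumption || lra).
  rewrite sn_sub_comm by assumption.
  nra.
Qed.

Definition skew_part x := scale X (RtoC (/ 2)) (sub X x (x^*)).

Lemma star_skew_part x : (skew_part x)^* = [-] skew_part x.
Proof.
unfold skew_part.
rewrite star_scale, <- sub_star_star, star_star, <- (opp_sub x).
rewrite scale_opp; do 2 f_equal.
unfold Cconj, RtoC; simpl; f_equal; ring.
Qed.

Lemma sn_skew_part x : p (skew_part x) <= p x.
Proof.
unfold skew_part; rewrite sn_scale, Cmod_RtoC_pos by (assumption || lra).
generalize (sn_sub p Hp x (x^*)); rewrite sn_star by assumption; lra.
Qed.

(** The second summand is the self-adjoint part, half of [x + x^*], written as a multiple of a skew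
    element so that [lift_skew] applies to both summands. *)
Lemma skew_part_decomp x :
  x = skew_part x [+] scale X (Copp Ci) (skew_part (scale X Ci x)).
Proof.
unfold skew_part.
rewrite star_scale, scale_scale, Cmult_comm, <- scale_scale, <- scale_add_r.
assert (E : sub X x (x^*) [+]
  scale X (Copp Ci) (sub X (scale X Ci x) (scale X (Cconj Ci) (x^*))) = x [+] x).
  unfold sub; rewrite scale_add_r, scale_opp, !scale_scale.
  replace (Cmult (Copp Ci) Ci) with (RtoC 1).
  2: unfold Cmult, Copp, Ci, RtoC; simpl; f_equal; ring.
  replace (Cmult (Copp Ci) (Cconj Ci)) with (RtoC (-1)).
  2: unfold Cmult, Cconj, Copp, Ci, RtoC; simpl; f_equal; ring.
  rewrite <- opp_scale, opp_opp, scale_one, (add_comm x (x^*)), <- add_assoc.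
  now rewrite opp_add_cancel.
rewrite E, scale_add_r, <- scale_add_l, <- RtoC_plus.
replace (/ 2 + / 2) with 1 by lra.
now rewrite scale_one.
Qed.

(** The two skew components are approximated separately, which doubles the constants of
    [lift_skew]. *)
Lemma lift_approx x e : T x -> 0 < e -> p x <= e ->
  exists y, T y /\ q y <= 48 * e /\ p (sub X x y) <= e / 4.
Proof.
intros Tx He Hx.
assert (Tskew : forall z, T z -> T (skew_part z)).
  intros z Tz; apply HT, HT; [assumption|now apply subalg_opp, HT].
assert (HCi : Cmod Ci = 1).
  unfold Cmod, Ci; simpl.
  replace (0 * (0 * 1) + 1 * (1 * 1)) with 1 by ring; apply sqrt_1.
destruct (lift_skew (skew_part x) e) as (y1 & T1 & q1 & p1);
  auto using star_skew_part.
  eapply Rle_trans; [apply sn_skew_part|assumption].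
destruct (lift_skew (skew_part (scale X Ci x)) e) as (y2 & T2 & q2 & p2);
  auto using star_skew_part.
    now apply Tskew, HT.
  eapply Rle_trans; [apply sn_skew_part|].
  rewrite sn_scale, HCi by assumption; lra.
exists (y1 [+] scale X (Copp Ci) y2); repeat split.
- apply HT; [|apply HT]; assumption.
- eapply Rle_trans; [now apply sn_add|].
  rewrite sn_scale, Cmod_opp, HCi by assumption; lra.
- rewrite (skew_part_decomp x) at 1.
  rewrite sub_add_add, sub_scale_scale.
  eapply Rle_trans; [now apply sn_add|].
  rewrite sn_scale, Cmod_opp, HCi by assumption; lra.
Qed.

End Lifting.

End StarAlgebra.

(** * Dependent choice and geometrically convergent sequences *)

Lemma dependent_choice_nat (Y : Type) (P : nat -> Y -> Prop)
    (Q : nat -> Y -> Y -> Prop) (y0 : Y) :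
  P 0%nat y0 ->
  (forall n y, P n y -> exists y', P (S n) y' /\ Q n y y') ->
  exists u : nat -> Y, forall n, P n (u n) /\ Q n (u n) (u (S n)).
Proof.
intros H0 Hstep.
set (next n y := epsilon (inhabits y) (fun y' => P (S n) y' /\ Q n y y')).
assert (Hnext : forall n y, P n y -> P (S n) (next n y) /\ Q n y (next n y)).
  intros n y Hy; unfold next; apply epsilon_spec; auto.
set (u := fix u n := match n with O => y0 | S n => next n (u n) end).
assert (Hu : forall n, P n (u n)).
  induction n as [|n IH]; [exact H0|exact (proj1 (Hnext _ _ IH))].
exists u; intros n; split; [apply Hu|exact (proj2 (Hnext _ _ (Hu n)))].
Qed.

Lemma geometric_cauchy (X : tsig) (p : X -> R) (u : nat -> X) c :
  star_alg_axioms X -> cstar_seminorm X p -> 0 <= c ->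
  (forall n, p (sub X (u (S n)) (u n)) <= c * (/ 2) ^ n) ->
  p_cauchy X p u.
Proof.
intros HX Hp Hc Hu.
(* Telescoped geometric series; keeping the subtracted tail lets the induction on [k] close. *)
assert (Hgeo : forall n k,
    p (sub X (u (n + k)%nat) (u n)) <= 2 * c * ((/ 2) ^ n - (/ 2) ^ (n + k))).
  intros n k; induction k as [|k IH].
    rewrite Nat.add_0_r, (sub_diag X HX), (sn_zero X HX p Hp); lra.
  rewrite Nat.add_succ_r.
  generalize (sn_sub_triangle X HX p Hp (u (n + k)%nat) (u (S (n + k))) (u n)).
  generalize (Hu (n + k)%nat); simpl; lra.
intros e He.
(* Both [u n] and [u m] lie within [2 * c * (/ 2) ^ N] of [u N], whence [4 * c]; the [+ 1] keeps the
   divisor positive when [c = 0]. *)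
destruct (pow_lt_1_zero (/ 2)) with (y := e / (4 * c + 1)) as [N HN].
- rewrite Rabs_pos_eq; lra.
- apply Rdiv_lt_0_compat; lra.
- assert (Hpos : forall m, 0 < (/ 2) ^ m) by (intros; apply pow_lt; lra).
  assert (Hb : 4 * c * (/ 2) ^ N < e).
    specialize (HN N (le_n N)).
    rewrite Rabs_pos_eq in HN by (generalize (Hpos N); lra).
    apply (Rmult_lt_compat_r (4 * c + 1)) in HN; [|lra].
    unfold Rdiv in HN; rewrite Rmult_assoc, Rinv_l in HN by lra.
    generalize (Hpos N); nra.
  exists N; intros n m Hn Hm.
  eapply Rle_lt_trans; [apply (sn_sub_triangle X HX p Hp (u N))|].
  rewrite (sn_sub_comm X HX p Hp (u N)).
  generalize (Hgeo N (n - N)%nat) (Hgeo N (m - N)%nat).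
  replace (N + (n - N))%nat with n by lia.
  replace (N + (m - N))%nat with m by lia.
  generalize (Hpos n) (Hpos m); nra.
Qed.

(** * Continuous C*-seminorms on a product, and closures of projections *)

Section Product.

Variables A B : tsig.

Lemma prod_star_alg :
  star_alg_axioms A -> star_alg_axioms B -> star_alg_axioms (prod_tsig A B).
Proof.
intros HA HB; unfold star_alg_axioms; simpl.
repeat split; intros; repeat (match goal with x : _ * _ |- _ => destruct x end);
  simpl; f_equal; first [apply HA | apply HB].
Qed.

Lemma NA_fst p : is_topology B -> NA A p ->
  NA (prod_tsig A B) (fun x => p (fst x)).
Proof.
intros HB [(Hadd & Hscale & Hmul & Hstar) Hc]; split.
  repeat split; intros; simpl; auto.
intros x e He; destruct (Hc (fst x) e He) as (U & HU & Ux & Hd).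
exists (fun y => U (fst y)); repeat split; simpl; auto.
intros y Uy; exists U, (fun _ => True); repeat split; auto; apply HB.
Qed.

Lemma NA_snd p : is_topology A -> NA B p ->
  NA (prod_tsig A B) (fun x => p (snd x)).
Proof.
intros HA [(Hadd & Hscale & Hmul & Hstar) Hc]; split.
  repeat split; intros; simpl; auto.
intros x e He; destruct (Hc (snd x) e He) as (U & HU & Ux & Hd).
exists (fun y => U (snd y)); repeat split; simpl; auto.
intros y Uy; exists (fun _ => True), U; repeat split; auto; apply HA.
Qed.

(** Pullback along the continuous *-homomorphism sending [a] to [(a, 0)]. *)
Lemma NA_restrict_fst p : star_alg_axioms B ->
  NA (prod_tsig A B) p -> NA A (fun a => p (a, zero B)).
Proof.
intros HB [(Hadd & Hscale & Hmul & Hstar) Hc]; split.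
  repeat split.
  - intros a b; generalize (Hadd (a, zero B) (b, zero B)); simpl.
    now rewrite (add_zero_r B HB).
  - intros l a; generalize (Hscale l (a, zero B)); simpl.
    now rewrite (scale_zero_r B HB).
  - intros a b; generalize (Hmul (a, zero B) (b, zero B)); simpl.
    now rewrite (mul_zero_r B HB).
  - intros a; generalize (Hstar (a, zero B)); simpl.
    now rewrite (mul_zero_r B HB).
intros x e He; destruct (Hc (x, zero B) e He) as (U & HU & Ux & Hd).
destruct (HU _ Ux) as (V & W & HV & HW & Vx & Wx & HVW).
exists V; repeat split; auto.
Qed.

Lemma NA_restrict_snd p : star_alg_axioms A ->
  NA (prod_tsig A B) p -> NA B (fun b => p (zero A, b)).
Proof.
intros HA [(Hadd & Hscale & Hmul & Hstar) Hc]; split.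
  repeat split.
  - intros a b; generalize (Hadd (zero A, a) (zero A, b)); simpl.
    now rewrite (add_zero_r A HA).
  - intros l a; generalize (Hscale l (zero A, a)); simpl.
    now rewrite (scale_zero_r A HA).
  - intros a b; generalize (Hmul (zero A, a) (zero A, b)); simpl.
    now rewrite (mul_zero_r A HA).
  - intros a; generalize (Hstar (zero A, a)); simpl.
    now rewrite (mul_zero_r A HA).
intros x e He; destruct (Hc (zero A, x) e He) as (U & HU & Ux & Hd).
destruct (HU _ Ux) as (V & W & HV & HW & Vx & Wx & HVW).
exists W; repeat split; auto.
Qed.

(** Split [(a, b)] as [(a, 0) + (0, b)] and use maximality on each factor. Hence membership in a
    closure in the product can be tested with [r] and [s] alone. *)
Lemma NA_prod_le p r s : star_alg_axioms A -> star_alg_axioms B ->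
  largest_NA A r -> largest_NA B s -> NA (prod_tsig A B) p ->
  forall a b, p (a, b) <= r a + s b.
Proof.
intros HA HB [_ Hr] [_ Hs] Hp a b.
generalize (Hr _ (NA_restrict_fst p HB Hp) a).
generalize (Hs _ (NA_restrict_snd p HA Hp) b).
generalize (proj1 (proj1 Hp) (a, zero B) (zero A, b)); simpl.
rewrite (add_zero_r A HA), (add_zero_l B HB); lra.
Qed.

(** Continuity of the second projection: each [p] in [N(B)] pulls back to a continuous C*-seminorm
    on the product. *)
Lemma proj_closure_sub (T : prod_tsig A B -> Prop) b : is_topology A ->
  proj2_img A B (cstar_closure (prod_tsig A B) T) b ->
  cstar_closure B (proj2_img A B T) b.
Proof.
intros HA [a Hab] ps Hps e He.
destruct (Hab (map (fun p x => p (snd x)) ps)) with (eps := e)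
  as ([a' b'] & Tx & Hx); auto.
  intros p Hp; apply in_map_iff in Hp; destruct Hp as (p' & <- & Hp').
  now apply NA_snd, Hps.
exists b'; split; [now exists a'|].
intros p Hp; exact (Hx _ (in_map (fun p (x : A * B) => p (snd x)) _ _ Hp)).
Qed.

(** One iteration: the error in the second coordinate is halved at the cost of a move in the first
    coordinate proportional to that error. *)
Lemma proj_closure_step (T : prod_tsig A B -> Prop) r s b z e :
  star_alg_axioms A -> star_alg_axioms B ->
  NA (prod_tsig A B) (fun x => r (fst x)) ->
  NA (prod_tsig A B) (fun x => s (snd x)) -> NA B s ->
  star_subalg (prod_tsig A B) T ->
  cstar_closure B (proj2_img A B T) b ->
  0 < e -> T z -> s (sub B b (snd z)) < e ->
  exists z', (T z' /\ s (sub B b (snd z')) < e / 2) /\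
    r (sub A (fst z') (fst z)) <= 54 * e.
Proof.
intros HA HB Hr Hs Hs' HT Hb He Tz Hz.
assert (HX := prod_star_alg HA HB).
destruct (Hb (s :: nil)) with (eps := e / 8) as (b' & [a' Tx] & Hx).
- intros p [<-|[]]; assumption.
- lra.
- specialize (Hx s (or_introl eq_refl)).
  set (x := (a', b') : prod_tsig A B).
  set (w := sub (prod_tsig A B) x z).
  assert (Tw : T w).
    apply HT; [assumption|now apply (subalg_opp _ HX _ HT)].
  assert (Hw : s (snd w) <= 9 / 8 * e).
    change (snd w) with (sub B b' (snd z)).
    generalize (sn_sub_triangle B HB s (proj1 Hs') b b' (snd z)).
    rewrite (sn_sub_comm B HB s (proj1 Hs') b' b); lra.
  (* The seminorm known to be small on [w] is [s] of the second coordinate, the one to be controlled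
     is [r] of the first. The constant 54 is [48 * 9 / 8]. *)
  destruct (lift_approx _ HX _ _ (proj1 Hs) (proj1 Hr) _ HT w (9 / 8 * e))
    as (y & Ty & Hry & Hsy); auto; try lra.
  exists (add (prod_tsig A B) z y); repeat split; simpl.
  + now apply HT.
  + assert (E : sub B b (add B (snd z) (snd y)) =
      add B (sub B b b') (sub B (sub B b' (snd z)) (snd y))).
      rewrite (sub_sub_sub B HB b b'); f_equal.
      unfold sub; now rewrite (opp_add B HB), (add_assoc B HB).
    rewrite E.
    (* The new error is below [e / 8 + 9 / 32 * e = 13 / 32 * e], hence below [e / 2]. *)
    generalize (sn_add B s (proj1 Hs') (sub B b b')
      (sub B (sub B b' (snd z)) (snd y))).
    change (s (sub B (sub B b' (snd z)) (snd y)) <= 9 / 8 * e / 4) in Hsy; lra.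
  + assert (E : sub A (add A (fst z) (fst y)) (fst z) = fst y).
      unfold sub; rewrite (add_comm A HA), (opp_add_cancel A HA); reflexivity.
    rewrite E; lra.
Qed.

Lemma closure_proj_sub (T : prod_tsig A B -> Prop) r s b :
  TStarAlg A -> TStarAlg B -> largest_NA A r -> largest_NA B s ->
  eta_surjective A r -> star_subalg (prod_tsig A B) T ->
  cstar_closure B (proj2_img A B T) b ->
  proj2_img A B (cstar_closure (prod_tsig A B) T) b.
Proof.
intros (HA & HAt & _) (HB & HBt & _) Hr Hs Heta HT Hb.
assert (Hr' := NA_fst r HBt (proj1 Hr)).
assert (Hs' := NA_snd s HAt (proj1 Hs)).
(* The iteration starts with error below [1 = (/ 2) ^ 0]. *)
destruct (Hb (s :: nil)) with (eps := 1) as (b0 & [a0 T0] & H0).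
  intros p [<-|[]]; apply Hs.
  lra.
specialize (H0 s (or_introl eq_refl)).
destruct (dependent_choice_nat (A * B)
  (fun n z => T z /\ s (sub B b (snd z)) < (/ 2) ^ n)
  (fun n z z' => r (sub A (fst z') (fst z)) <= 54 * (/ 2) ^ n) (a0, b0))
  as [z Hz].
- split; [assumption|simpl; lra].
- intros n z [Tz Hz].
  destruct (proj_closure_step T r s b z ((/ 2) ^ n))
    as (z' & [Tz' Hz'] & Hzz'); auto; try apply Hs.
    apply pow_lt; lra.
  exists z'; repeat split; auto.
  simpl; lra.
- assert (Hc : p_cauchy A r (fun n => fst (z n))).
    apply (geometric_cauchy A r _ 54 HA); try apply Hr; [lra|].
    intros n; apply Hz.
  destruct (Heta (exist _ _ Hc)) as [a Ha]; simpl in Ha.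
  (* The first coordinates converge to [a] in [r], the second ones to [b] in [s]; as every [p] in
     the list is dominated by [r + s], a single late term [z n] serves the whole list. *)
  exists a; intros ps Hps e He.
  destruct (Ha (e / 2)) as [N HN]; [lra|].
  destruct (pow_lt_1_zero (/ 2)) with (y := e / 2) as [M HM].
    rewrite Rabs_pos_eq; lra.
    lra.
  set (n := max N M).
  exists (z n); split; [apply Hz|].
  intros p Hp.
  eapply Rle_lt_trans.
    apply (NA_prod_le p r s HA HB Hr Hs (Hps p Hp)
      (sub A a (fst (z n))) (sub B b (snd (z n)))).
  assert (h1 : r (sub A a (fst (z n))) < e / 2) by (apply HN; lia).
  assert (h2 : (/ 2) ^ n < e / 2).
    eapply Rle_lt_trans; [apply Rle_abs|apply HM; lia].
  destruct (Hz n) as [[_ h3] _]; lra.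
Qed.

End Product.

(** * The topology defined by a single C*-seminorm *)

Section SeminormTopology.

Variables (X : tsig) (p : X -> R).
Hypotheses (HX : star_alg_axioms X) (Hp : cstar_seminorm X p).
Hypothesis HO : forall U, opens X U <->
  (forall x, U x -> exists e, 0 < e /\ forall y, p (sub X y x) < e -> U y).

Let ball x e := fun y => p (sub X y x) < e.

Lemma ball_open x e : opens X (ball x e).
Proof.
apply HO; intros y Hy; unfold ball in *.
exists (e - p (sub X y x)); split; [lra|].
intros z Hz; generalize (sn_sub_triangle X HX p Hp y z x); lra.
Qed.

Lemma ball_center x e : 0 < e -> ball x e x.
Proof. unfold ball; now rewrite (sub_diag X HX), (sn_zero X HX p Hp). Qed.

Lemma seminorm_topology_cont1 f :
  (forall x y, p (sub X (f y) (f x)) <= p (sub X y x)) -> cont1 X f.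
Proof.
intros Hf x U HU Ux.
destruct (proj1 (HO U) HU _ Ux) as (e & He & HeU).
exists (ball x e); split; [apply ball_open|]; split; [now apply ball_center|].
intros y Hy; apply HeU; unfold ball in Hy; generalize (Hf x y); lra.
Qed.

Lemma seminorm_topology_TStarAlg : TStarAlg X.
Proof.
split; [exact HX|]; repeat split.
- apply HO; intros; exists 1; split; [lra|auto].
- intros F HF; apply HO; intros x (U & FU & Ux).
  destruct (proj1 (HO U) (HF U FU) _ Ux) as (e & He & HeU).
  exists e; split; [assumption|]; intros y Hy; exists U; auto.
- intros U V HU HV; apply HO; intros x [Ux Vx].
  destruct (proj1 (HO U) HU _ Ux) as (e & He & HeU).
  destruct (proj1 (HO V) HV _ Vx) as (d & Hd & HdV).
  exists (Rmin e d); split; [now apply Rmin_glb_lt|].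
  generalize (Rmin_l e d) (Rmin_r e d); intros h1 h2 y Hy.
  split; [apply HeU|apply HdV]; lra.
- intros x y U HU Uxy.
  destruct (proj1 (HO U) HU _ Uxy) as (e & He & HeU).
  exists (ball x (e / 2)), (ball y (e / 2)).
  do 2 (split; [apply ball_open|]); do 2 (split; [apply ball_center; lra|]).
  unfold ball; intros x' y' Hx Hy; apply HeU.
  rewrite (sub_add_add X HX).
  generalize (sn_add X p Hp (sub X x' x) (sub X y' y)); lra.
- intros x y U HU Uxy.
  destruct (proj1 (HO U) HU _ Uxy) as (e & He & HeU).
  generalize (sn_ge0 X HX p Hp x) (sn_ge0 X HX p Hp y); intros Hx0 Hy0.
  (* The product changes by less than [(p x + d) * d + d * p y], which is at most [d * K] because
     [d <= 1]. *)
  set (K := 1 + p x + p y).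
  set (d := Rmin 1 (e / K)).
  assert (HeK : 0 < e / K) by (apply Rdiv_lt_0_compat; unfold K; lra).
  assert (Hd : 0 < d) by (apply Rmin_glb_lt; lra).
  assert (Hd1 : d <= 1) by apply Rmin_l.
  assert (HdK : d * K <= e).
    replace e with (e / K * K) by (field; unfold K; lra).
    apply Rmult_le_compat_r; [unfold K; lra|apply Rmin_r].
  exists (ball x d), (ball y d).
  do 2 (split; [apply ball_open|]); do 2 (split; [now apply ball_center|]).
  unfold ball; intros x' y' Hx Hy; apply HeU.
  rewrite (sub_mul_mul X HX).
  generalize (sn_add X p Hp (mul X x' (sub X y' y)) (mul X (sub X x' x) y)).
  generalize (sn_mul X p Hp x' (sub X y' y)) (sn_mul X p Hp (sub X x' x) y).
  generalize (sn_le_sub X HX p Hp x' x) (sn_ge0 X HX p Hp x').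
  generalize (sn_ge0 X HX p Hp (sub X y' y)) (sn_ge0 X HX p Hp (sub X x' x)).
  intros h1 h2 h3 h4 h5 h6 h7.
  assert (p x' * p (sub X y' y) <= (p x + d) * p (sub X y' y)).
    apply Rmult_le_compat_r; lra.
  assert ((p x + d) * p (sub X y' y) < (p x + d) * d).
    apply Rmult_lt_compat_l; lra.
  assert (p (sub X x' x) * p y <= d * p y) by (apply Rmult_le_compat_r; lra).
  unfold K in HdK; nra.
- apply seminorm_topology_cont1; intros x y.
  rewrite (sub_opp_opp X HX), (sn_opp X HX p Hp); lra.
- apply seminorm_topology_cont1; intros x y.
  rewrite (sub_star_star X HX), (sn_star X HX p Hp); lra.
Qed.

Lemma seminorm_topology_NA : NA X p.
Proof.
split; [exact Hp|]; intros x e He.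
exists (ball x e); split; [apply ball_open|]; split; [now apply ball_center|].
intros y Hy; eapply Rle_lt_trans; [now apply sn_dist|exact Hy].
Qed.

End SeminormTopology.

(** * The completion as an algebra of Cauchy sequences *)

Section CauchySequences.

Variables (A : tsig) (r : A -> R).
Hypotheses (HA : star_alg_axioms A) (Hr : cstar_seminorm A r).

Lemma p_cauchy_const a : p_cauchy A r (fun _ => a).
Proof.
intros e He; exists 0%nat; intros.
now rewrite (sub_diag A HA), (sn_zero A HA r Hr).
Qed.

Lemma p_cauchy_add u v :
  p_cauchy A r u -> p_cauchy A r v -> p_cauchy A r (fun n => add A (u n) (v n)).
Proof.
intros Hu Hv e He.
destruct (Hu (e / 2)) as [N HN]; [lra|].
destruct (Hv (e / 2)) as [M HM]; [lra|].
exists (max N M); intros n m Hn Hm.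
rewrite (sub_add_add A HA).
generalize (sn_add A r Hr (sub A (u n) (u m)) (sub A (v n) (v m))).
generalize (HN n m ltac:(lia) ltac:(lia)) (HM n m ltac:(lia) ltac:(lia)); lra.
Qed.

Lemma p_cauchy_scale l u :
  p_cauchy A r u -> p_cauchy A r (fun n => scale A l (u n)).
Proof.
intros Hu e He; generalize (Cmod_ge_0 l); intros Hl.
destruct (Hu (e / (Cmod l + 1))) as [N HN].
  apply Rdiv_lt_0_compat; lra.
exists N; intros n m Hn Hm.
rewrite (sub_scale_scale A HA), (sn_scale A r Hr).
specialize (HN n m Hn Hm).
apply (Rmult_lt_compat_l (Cmod l + 1)) in HN; [|lra].
replace ((Cmod l + 1) * (e / (Cmod l + 1))) with e in HN by (field; lra).
generalize (sn_ge0 A HA r Hr (sub A (u n) (u m))); lra.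
Qed.

Lemma p_cauchy_opp u : p_cauchy A r u -> p_cauchy A r (fun n => opp A (u n)).
Proof.
intros Hu e He; destruct (Hu e He) as [N HN]; exists N; intros n m Hn Hm.
now rewrite (sub_opp_opp A HA), (sn_opp A HA r Hr); apply HN.
Qed.

Lemma p_cauchy_star u : p_cauchy A r u -> p_cauchy A r (fun n => star A (u n)).
Proof.
intros Hu e He; destruct (Hu e He) as [N HN]; exists N; intros n m Hn Hm.
now rewrite (sub_star_star A HA), (sn_star A HA r Hr); apply HN.
Qed.

Lemma p_cauchy_mul u v :
  p_cauchy A r u -> p_cauchy A r v -> p_cauchy A r (fun n => mul A (u n) (v n)).
Proof.
intros Hu Hv e He.
destruct (Hu 1) as [N1 HN1]; [lra|].
destruct (Hv 1) as [M1 HM1]; [lra|].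
(* [K] bounds the tails of both sequences, each of which stays within 1 of a fixed term. *)
set (K := r (u N1) + r (v M1) + 2).
assert (HK : 2 <= K).
  unfold K; generalize (sn_ge0 A HA r Hr (u N1)) (sn_ge0 A HA r Hr (v M1)); lra.
assert (HeK : 0 < e / (2 * K)) by (apply Rdiv_lt_0_compat; lra).
destruct (Hu _ HeK) as [N HN]; destruct (Hv _ HeK) as [M HM].
exists (max (max N M) (max N1 M1)); intros n m Hn Hm.
rewrite (sub_mul_mul A HA).
generalize (sn_add A r Hr (mul A (u n) (sub A (v n) (v m)))
  (mul A (sub A (u n) (u m)) (v m))).
generalize (sn_mul A r Hr (u n) (sub A (v n) (v m))).
generalize (sn_mul A r Hr (sub A (u n) (u m)) (v m)).
assert (h1 : r (u n) <= K).
  generalize (sn_le_sub A HA r Hr (u n) (u N1)) (sn_ge0 A HA r Hr (v M1)).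
  generalize (HN1 n N1 ltac:(lia) ltac:(lia)); unfold K; lra.
assert (h2 : r (v m) <= K).
  generalize (sn_le_sub A HA r Hr (v m) (v M1)) (sn_ge0 A HA r Hr (u N1)).
  generalize (HM1 m M1 ltac:(lia) ltac:(lia)); unfold K; lra.
generalize (HN n m ltac:(lia) ltac:(lia)) (HM n m ltac:(lia) ltac:(lia)).
generalize (sn_ge0 A HA r Hr (sub A (u n) (u m))).
generalize (sn_ge0 A HA r Hr (sub A (v n) (v m))).
intros h3 h4 h5 h6 h7 h8 h9.
assert (h10 : r (u n) * r (sub A (v n) (v m)) <= K * r (sub A (v n) (v m))).
  now apply Rmult_le_compat_r.
assert (h11 : r (sub A (u n) (u m)) * r (v m) <= r (sub A (u n) (u m)) * K).
  now apply Rmult_le_compat_l.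
assert (h12 : e / (2 * K) * K = e / 2) by (field; lra).
nra.
Qed.

(** The limit exists and is finite by [is_lim_seq_norm], so [real] returns its true value. *)
Definition seq_norm (u : completion_pt A r) : R :=
  real (Lim_seq (fun n => r (proj1_sig u n))).

(** The completion before identifying sequences at distance zero; the topology
    need not be Hausdorff, so no quotient is required. *)
Definition seq_alg : tsig :=
  TSig (completion_pt A r)
    (exist _ _ (p_cauchy_const (zero A)))
    (fun u v => exist _ _ (p_cauchy_add _ _ (proj2_sig u) (proj2_sig v)))
    (fun u => exist _ _ (p_cauchy_opp _ (proj2_sig u)))
    (fun u v => exist _ _ (p_cauchy_mul _ _ (proj2_sig u) (proj2_sig v)))
    (fun l u => exist _ _ (p_cauchy_scale l _ (proj2_sig u)))
    (fun u => exist _ _ (p_cauchy_star _ (proj2_sig u)))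
    (fun U => forall u, U u -> exists e, 0 < e /\ forall v : completion_pt A r,
       seq_norm (exist _ _ (p_cauchy_add _ _ (proj2_sig v)
         (p_cauchy_opp _ (proj2_sig u)))) < e -> U v).

Definition seq_const (a : A) : seq_alg := exist _ _ (p_cauchy_const a).

(** The algebra axioms demand equality on the nose, not up to distance zero; they hold termwise, and
    proof irrelevance identifies the Cauchy certificates. *)
Lemma seq_alg_ext (u v : seq_alg) :
  (forall n, proj1_sig u n = proj1_sig v n) -> u = v.
Proof.
destruct u as [u Hu], v as [v Hv]; simpl; intros E.
assert (E' : u = v) by now apply functional_extensionality.
subst v; f_equal; apply proof_irrelevance.
Qed.

Lemma seq_alg_star_alg : star_alg_axioms seq_alg.
Proof.
unfold star_alg_axioms; repeat split; intros; apply seq_alg_ext; intros n;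
  simpl; apply HA.
Qed.

Lemma is_lim_seq_norm (u : seq_alg) :
  is_lim_seq (fun n => r (proj1_sig u n)) (seq_norm u).
Proof.
apply Lim_seq_correct', ex_lim_seq_cauchy_corr.
intros e; destruct (proj2_sig u e (cond_pos e)) as [N HN].
exists N; intros n m Hn Hm.
eapply Rle_lt_trans; [apply (sn_dist A HA r Hr)|now apply HN].
Qed.

Lemma seq_norm_unique (u : seq_alg) (f : nat -> R) (l : R) :
  (forall n, r (proj1_sig u n) = f n) -> is_lim_seq f l -> seq_norm u = l.
Proof.
intros E Hf; unfold seq_norm.
now rewrite (is_lim_seq_unique _ l (is_lim_seq_ext _ _ _ (fun n => eq_sym (E n)) Hf)).
Qed.

Lemma seq_norm_const a : seq_norm (seq_const a) = r a.
Proof.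
apply (seq_norm_unique _ (fun _ => r a)); [reflexivity|apply is_lim_seq_const].
Qed.

Lemma seq_norm_cstar : cstar_seminorm seq_alg seq_norm.
Proof.
repeat split.
- intros u v.
  apply (is_lim_seq_le _ _ (seq_norm (add seq_alg u v)) (seq_norm u + seq_norm v)
    (fun n => sn_add A r Hr (proj1_sig u n) (proj1_sig v n))).
    exact (is_lim_seq_norm (add seq_alg u v)).
  apply is_lim_seq_plus'; apply is_lim_seq_norm.
- intros l u; apply (seq_norm_unique _ (fun n => Cmod l * r (proj1_sig u n))).
    intros n; simpl; now apply sn_scale.
  apply (is_lim_seq_scal_l _ (Cmod l) (seq_norm u)), is_lim_seq_norm.
- intros u v.
  apply (is_lim_seq_le _ _ (seq_norm (mul seq_alg u v)) (seq_norm u * seq_norm v)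
    (fun n => sn_mul A r Hr (proj1_sig u n) (proj1_sig v n))).
    exact (is_lim_seq_norm (mul seq_alg u v)).
  apply is_lim_seq_mult'; apply is_lim_seq_norm.
- intros u; apply (seq_norm_unique _
    (fun n => r (proj1_sig u n) * r (proj1_sig u n))).
    intros n; simpl; rewrite (sn_star_mul A r Hr); ring.
  replace (seq_norm u ^ 2) with (seq_norm u * seq_norm u) by ring.
  apply is_lim_seq_mult'; apply is_lim_seq_norm.
Qed.

(** Inside the definition of [seq_alg] its own [sub] is not yet available, so differences are
    spelled out there; the two forms are convertible. *)
Lemma seq_alg_opens U : opens seq_alg U <->
  (forall x, U x -> exists e, 0 < e /\
     forall y, seq_norm (sub seq_alg y x) < e -> U y).
Proof. reflexivity. Qed.

Lemma seq_norm_lt (u : seq_alg) e : seq_norm u < e ->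
  exists N, forall n, (N <= n)%nat -> r (proj1_sig u n) < e.
Proof.
intros H.
destruct (proj2 (is_lim_seq_spec _ _) (is_lim_seq_norm u)
  (mkposreal (e - seq_norm u) ltac:(lra))) as [N HN]; simpl in HN.
exists N; intros n Hn; specialize (HN n Hn); apply Rabs_def2 in HN; lra.
Qed.

Lemma seq_const_dense (u : seq_alg) e : 0 < e ->
  exists a, seq_norm (sub seq_alg u (seq_const a)) < e.
Proof.
(* A late term of [u] is taken as the constant; [e / 2] leaves room because limits preserve only
   weak inequalities. *)
intros He; destruct (proj2_sig u (e / 2)) as [N HN]; [lra|].
exists (proj1_sig u N).
apply Rle_lt_trans with (e / 2); [|lra].
apply (is_lim_seq_le_loc (fun n => r (sub A (proj1_sig u n) (proj1_sig u N)))
  (fun _ => e / 2) (seq_norm (sub seq_alg u (seq_const (proj1_sig u N)))) (e / 2)).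
- exists N; intros n Hn; left; now apply HN.
- exact (is_lim_seq_norm (sub seq_alg u (seq_const (proj1_sig u N)))).
- apply is_lim_seq_const.
Qed.

Lemma NA_seq_const p : TStarAlg A -> continuous_real A r -> NA seq_alg p ->
  NA A (fun a => p (seq_const a)).
Proof.
intros (_ & _ & HcA & _) Hrc [(Hadd & Hscale & Hmul & Hstar) Hc].
assert (Eadd : forall a b,
    seq_const (add A a b) = add seq_alg (seq_const a) (seq_const b)).
  intros; now apply seq_alg_ext.
assert (Escale : forall l a,
    seq_const (scale A l a) = scale seq_alg l (seq_const a)).
  intros; now apply seq_alg_ext.
assert (Emul : forall a b,
    seq_const (mul A a b) = mul seq_alg (seq_const a) (seq_const b)).
  intros; now apply seq_alg_ext.
assert (Estar : forall a, seq_const (star A a) = star seq_alg (seq_const a)).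
  intros; now apply seq_alg_ext.
split.
  repeat split; intros; rewrite ?Eadd, ?Escale, ?Emul, ?Estar; auto.
intros x e He; destruct (Hc (seq_const x) e He) as (U & HU & Ux & Hd).
destruct (HU _ Ux) as (d & Hd0 & HdU).
(* Smallness of [r (sub A y x)] near [x] comes from continuity of [r] at zero, transported by
   continuity of addition at [(x, opp A x)]. *)
destruct (Hrc (zero A) d Hd0) as (V & HV & V0 & HVd).
rewrite <- (add_opp_r A HA x) in V0.
destruct (HcA x (opp A x) V HV V0) as (W1 & W2 & HW1 & _ & Wx1 & Wx2 & HW).
exists W1; repeat split; auto.
intros y Wy; apply Hd, HdU.
apply Rle_lt_trans with (r (sub A y x)).
  right; exact (seq_norm_const (sub A y x)).
specialize (HVd _ (HW y (opp A x) Wy Wx2)).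
rewrite (sn_zero A HA r Hr), Rminus_0_r in HVd.
eapply Rle_lt_trans; [apply Rle_abs|exact HVd].
Qed.

(** On constant sequences [p] is bounded by [r] through maximality of [r]; density of the constants
    and continuity of [p] extend the bound. This puts [seq_alg] in the class of test algebras for
    compactness. *)
Lemma seq_norm_largest : TStarAlg A -> largest_NA A r ->
  largest_NA seq_alg seq_norm.
Proof.
intros HtA [[_ Hrc] Hmax]; split.
  exact (seminorm_topology_NA seq_alg seq_norm seq_alg_star_alg seq_norm_cstar
    seq_alg_opens).
intros p Hp u.
assert (Hpr := Hmax _ (NA_seq_const p HtA Hrc Hp)).
apply le_epsilon; intros e He.
destruct (proj2 Hp u (e / 2)) as (U & HU & Uu & HUe); [lra|].
destruct (HU u Uu) as (d & Hd & HdU).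
(* Distance below [d] keeps [p] within [e / 2] of [p u], and distance below [e / 2] does the same
   for [seq_norm]. *)
destruct (seq_const_dense u (Rmin (e / 2) d)) as [a Ha].
  apply Rmin_glb_lt; lra.
generalize (Rmin_l (e / 2) d) (Rmin_r (e / 2) d); intros h1 h2.
rewrite (sn_sub_comm _ seq_alg_star_alg _ seq_norm_cstar) in Ha.
assert (Ua : U (seq_const a)).
  apply HdU; change (seq_norm (sub seq_alg (seq_const a) u) < d); lra.
apply HUe, Rabs_def2 in Ua.
generalize (Hpr a); rewrite <- seq_norm_const; simpl; intros h3.
generalize (sn_le_sub _ seq_alg_star_alg _ seq_norm_cstar (seq_const a) u).
lra.
Qed.

Definition seq_graph (x : prod_tsig A seq_alg) : Prop := snd x = seq_const (fst x).

Lemma seq_graph_subalg : star_subalg (prod_tsig A seq_alg) seq_graph.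
Proof.
unfold seq_graph; split; [|split; [|split; [|split]]]; simpl.
- now apply seq_alg_ext.
- intros a b Ha Hb; rewrite Ha, Hb; now apply seq_alg_ext.
- intros l a Ha; rewrite Ha; now apply seq_alg_ext.
- intros a b Ha Hb; rewrite Ha, Hb; now apply seq_alg_ext.
- intros a Ha; rewrite Ha; now apply seq_alg_ext.
Qed.

Lemma cstar_compact_eta_surjective :
  TStarAlg A -> largest_NA A r -> cstar_compact A -> eta_surjective A r.
Proof.
intros HtA Hmax HcA z.
assert (Hz := seq_norm_largest HtA Hmax).
assert (HtB : TStarAlg seq_alg).
  exact (seminorm_topology_TStarAlg seq_alg seq_norm seq_alg_star_alg
    seq_norm_cstar seq_alg_opens).
(* All seminorms of the list are dominated by [seq_norm], so one constant sequence close to [z]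
   approximates in all of them. *)
assert (Hcl : cstar_closure seq_alg (proj2_img A seq_alg seq_graph) z).
  intros ps Hps e He; destruct (seq_const_dense z e He) as [a Ha].
  exists (seq_const a); split; [now exists a|].
  intros p Hp; eapply Rle_lt_trans; [|exact Ha].
  now apply Hz, Hps.
apply (HcA seq_alg) in Hcl; [|split; eauto|apply seq_graph_subalg].
destruct Hcl as [a Ha]; exists a; intros e He.
(* Compactness placed [(a, z)] in the closure of the graph. Testing with these two seminorms gives
   one [a'] within [e / 2] of both [a] and [z], and the triangle inequality through [a'] compares
   [a] with the terms of [z]. *)
destruct (Ha ((fun x => r (fst x)) :: (fun x => seq_norm (snd x)) :: nil))
  with (eps := e / 2) as ([a' b'] & Hab & Hlt).
- intros p [<-|[<-|[]]].
    apply NA_fst; [apply HtB|apply Hmax].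
  apply NA_snd; [apply HtA|apply Hz].
- lra.
- unfold seq_graph in Hab; simpl in Hab; subst b'.
  generalize (Hlt _ (or_introl eq_refl)) (Hlt _ (or_intror (or_introl eq_refl))).
  simpl; intros h1 h2.
  apply (seq_norm_lt (sub seq_alg z (seq_const a'))) in h2.
  destruct h2 as [N HN]; exists N; intros n Hn.
  change (r (sub A a a') < e / 2) in h1.
  specialize (HN n Hn); change (r (sub A (proj1_sig z n) a') < e / 2) in HN.
  rewrite (sn_sub_comm A HA r Hr) in HN.
  generalize (sn_sub_triangle A HA r Hr a' a (proj1_sig z n)); lra.
Qed.

End CauchySequences.

Theorem theorem5p6 (A : tsig) (r : car A -> R) :
  GStarA A -> largest_NA A r ->
  (cstar_compact A <-> eta_surjective A r).
Proof.
intros [HtA _] Hr; split.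
  apply cstar_compact_eta_surjective; auto; [apply HtA|apply Hr].
intros Heta B [HtB [s Hs]] T HT b; split.
  apply proj_closure_sub, HtA.
now apply closure_proj_sub with r s.
Qed.
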